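(* Let $\varepsilon>0$, let $p\in(1,\infty)$, and let $f\in C^1(\mathbb{R})$ with $f(0)=f'(0)=0$ and $f'$ locally Hölder continuous on $\mathbb{R}$. Assume that $f$ satisfies the $p$-condition, and let $a>0$ be the corresponding constant in the $p$-condition. Let $u(x,t)$ be the solution of $$u_t+f(u)_x=\varepsilon u_{xx},\qquad x\in\mathbb{R},\ t>0,$$ subject to the initial condition $0\le u(x,0)=u_0(x)\in L^1(\mathbb{R})$. Then for all $t>0$, $$\|u(\cdot,t)\|_{L^\infty(\mathbb{R})}\le \|u_0\|_{L^1(\mathbb{R})}^{1/p}\,(at)^{-1/p}.$$
   Context: **Solution.** For $u_0\in L^1(\mathbb{R})\cap L^\infty(\mathbb{R})$ the equation has a unique global classical solution on $\mathbb{R}\times(0,\infty)$ with $-\|u_0\|_\infty\le u\le\|u_0\|_\infty$ that converges to $u_0$ in $L^1(\mathbb{R})$ as $t\to0$. The solution operator $S(t)u_0=u(\cdot,t)$ is a contraction in the $L^1$ norm, and for general $u_0\in L^1(\mathbb{R})$ the solution is $u(\cdot,t)=S(t)u_0$, where $S(t)$ is extended by continuity to $L^1(\mathbb{R})$. **The $p$-condition.** Let $\Psi\in C^1[0,\infty)$ be a nonnegative function for which there exists a family $\{\Phi_\eta\}_{\eta>0}$ of nonnegative smooth functions on $[0,\infty)$ such that (i) $\Phi_\eta(0)=0$ for all $\eta>0$, and (ii) $\Phi_\eta(r^2)\to\Psi(r)$ as $\eta\to0^+$, uniformly in compact intervals of $[0,\infty)$. Set $\Theta_\eta(r)=2r\Phi_\eta'(r)-\Phi_\eta(r)$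 for $r\ge0$, $\eta>0$. For $p\in(1,\infty)$, $\Psi$ satisfies the $p$-condition if there exist (for such a family) constants $\gamma>0$, $a>0$, $b>0$ such that $\Theta_\eta(r)\ge a\,r^{p/2}-b\,\eta^\gamma$ for all $r>0$ and all sufficiently small $\eta>0$. A function $f$ on $\mathbb{R}$ satisfies the $p$-condition if its restriction $\Psi=f|_{[0,\infty)}$ does (in particular $f\ge0$ on $[0,\infty)$). *)

(* Defs.v *)
From HB Require Import structures.
From mathcomp Require Import all_boot all_order all_algebra.
From mathcomp Require Import all_classical all_reals all_analysis.

Set Implicit Arguments.
Unset Strict Implicit.
Unset Printing Implicit Defensive.

Import Order.TTheory GRing.Theory Num.Theory.
Import numFieldNormedType.Exports.

Local Open Scope classical_set_scope.
Local Open Scope ring_scope.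

Definition C1 (R : realType) (f : R -> R) : Prop :=
  (forall x : R, derivable f x 1) /\ continuous (derive1 f).

Definition locally_Holder (R : realType) (g : R -> R) : Prop :=
  forall x : R, exists alpha C delta : R,
    [/\ 0 < alpha <= 1, 0 < delta &
        forall y z : R, ball x delta y -> ball x delta z ->
          `|g y - g z| <= C * `|y - z| `^ alpha].

(* Regularity on [0, +oo[ means regularity on ]0, +oo[ with all the derivatives
   involved having finite limits at 0^+, so that values at negative arguments
   play no role. *)
Definition C1_ge0 (R : realType) (g : R -> R) : Prop :=
  [/\ {within `[0, +oo[, continuous g},
      forall x : R, 0 < x -> derivable g x 1,
      forall x : R, 0 < x -> {for x, continuous (derive1 g)} &
      cvg (derive1 g x @[x --> 0^'+])].

Definition smooth_ge0 (R : realType) (g : R -> R) : Prop :=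
  {within `[0, +oo[, continuous g} /\
  forall n, (forall x : R, 0 < x -> derivable (derive1n n g) x 1) /\
            cvg (derive1n n g x @[x --> 0^'+]).

Definition Theta (R : realType) (Phi : R -> R -> R) (eta r : R) : R :=
  2 * r * derive1 (Phi eta) r - Phi eta r.

(* The constant a is a parameter, since it enters the conclusion of the
   decay estimate. *)
Definition p_condition (R : realType) (p a : R) (Psi : R -> R) : Prop :=
  [/\ C1_ge0 Psi,
      forall r : R, 0 <= r -> 0 <= Psi r &
      exists Phi : R -> R -> R,
        [/\ forall eta : R, 0 < eta ->
              smooth_ge0 (Phi eta) /\ (forall r : R, 0 <= r -> 0 <= Phi eta r),
            forall eta : R, 0 < eta -> Phi eta 0 = 0,
            forall c d : R, 0 <= c -> c <= d ->
              {uniform `[c, d],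
                (fun r => Phi eta (r ^+ 2)) @[eta --> 0^'+] --> Psi} &
            exists gamma b : R,
              [/\ 0 < gamma, 0 < a, 0 < b &
                  \forall eta \near 0^'+, forall r : R, 0 < r ->
                    a * r `^ (p / 2) - b * eta `^ gamma <= Theta Phi eta r]]].

(* u x t is the value at position x and time t; only times t > 0 matter. *)
Definition classical_solution (R : realType) (eps : R) (f : R -> R)
    (u : R -> R -> R) : Prop :=
  let Dt x t := derive1 (fun s => u x s) t in
  let Dx x t := derive1 (fun y => u y t) x in
  let Dxx x t := derive1 (fun y => Dx y t) x in
  forall x t : R, 0 < t ->
    [/\ derivable (fun s => u x s) t 1,
        derivable (fun y => u y t) x 1,
        derivable (fun y => Dx y t) x 1,
        [/\ {for (x, t), continuous (fun z : R * R => u z.1 z.2)},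
            {for (x, t), continuous (fun z : R * R => Dt z.1 z.2)},
            {for (x, t), continuous (fun z : R * R => Dx z.1 z.2)} &
            {for (x, t), continuous (fun z : R * R => Dxx z.1 z.2)}] &
        Dt x t + derive1 (fun y => f (u y t)) x = eps * Dxx x t].

Definition normL1 (R : realType) (g : R -> R) : \bar R :=
  'N[@lebesgue_measure R]_1[EFin \o g]%E.

Definition normLoo (R : realType) (g : R -> R) : \bar R :=
  'N[@lebesgue_measure R]_(+oo)[EFin \o g]%E.

Definition L1 (R : realType) (g : R -> R) : Prop :=
  g \in Lfun (@lebesgue_measure R) 1%E.

Definition Loo (R : realType) (g : R -> R) : Prop :=
  g \in Lfun (@lebesgue_measure R) +oo%E.

(* u x t = (S(t) u0) x for u0 in L^1 and L^oo. *)
Definition bounded_solution (R : realType) (eps : R) (f u0 : R -> R)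
    (u : R -> R -> R) : Prop :=
  [/\ classical_solution eps f u,
      forall x t : R, 0 < t -> (- normLoo u0 <= (u x t)%:E <= normLoo u0)%E,
      forall t : R, 0 < t -> L1 (u ^~ t) &
      normL1 (fun x => u x t - u0 x) @[t --> 0^'+] --> 0%E].

(* u(., t) = S(t) u0 for u0 in L^1, where S(t) is extended by continuity from
   the intersection of L^1 and L^oo: S(t) u0 is the L^1-limit of S(t) v for v
   in this intersection tending to u0 in L^1. As S(t) u0 is an element of L^1,
   u ^~ t is only determined up to a Lebesgue-negligible set. *)
Definition L1_solution (R : realType) (eps : R) (f u0 : R -> R)
    (u : R -> R -> R) : Prop :=
  (forall t : R, 0 < t -> L1 (u ^~ t)) /\
  forall v : nat -> R -> R,
    (forall n, L1 (v n) /\ Loo (v n)) ->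
    normL1 (fun x => v n x - u0 x) @[n --> \oo] --> 0%E ->
    exists w : nat -> R -> R -> R,
      (forall n, bounded_solution eps f (v n) (w n)) /\
      forall t : R, 0 < t ->
        normL1 (fun x => w n x t - u x t) @[n --> \oo] --> 0%E.

(* Main.v *)
Require Import Defs.
From HB Require Import structures.
From mathcomp Require Import all_boot all_order all_algebra.
From mathcomp Require Import all_classical all_reals all_analysis.
From mathcomp Require Import measurable_realfun ess_sup_inf.
From mathcomp Require Import ring lra.

Import Order.TTheory GRing.Theory Num.Theory.
Import numFieldNormedType.Exports.

Local Open Scope classical_set_scope.
Local Open Scope ring_scope.

(* A solution w with nonnegative bounded data v has a potential U on every
   half-plane t > s' > 0: U_x = w and U_t = eps w_x - f(w). With the linear
   operator L = d_t + f'(w) d_x - eps d_xx one has L w = 0 and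
   L U = w f'(w) - f(w) >= a w^p, the last inequality being what remains of the
   p-condition when eta -> 0. For fixed q, convexity of r |-> r^p gives
     L (U - a (t - s) (q^p + p q^(p-1) (w - q))) >= 0,
   so by the maximum principle on t >= s,
     a (t - s) w^p <= U - inf U(., s) <= sup U(., s) - inf U(., s).
   As s -> 0 the right-hand side tends to at most the L^1 norm of v. Finally v
   runs through truncations of u0, and the pointwise bound passes to the
   L^1-limit. *)

(** * One-variable calculus *)

Lemma is_derive_cont {R : realType} (f : R -> R) (x l : R) :
  is_derive x 1 f l -> {for x, continuous f}.
Proof. by move=> fl; apply/differentiable_continuous/derivable1_diffP. Qed.

Lemma is_derive_addr {R : realType} (f g : R -> R) (x a b : R) :
  is_derive x 1 f a -> is_derive x 1 g b ->
  is_derive x 1 (fun y => f y + g y) (a + b).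
Proof. exact: is_deriveD. Qed.

Lemma is_derive_subr {R : realType} (f g : R -> R) (x a b : R) :
  is_derive x 1 f a -> is_derive x 1 g b ->
  is_derive x 1 (fun y => f y - g y) (a - b).
Proof. exact: is_deriveB. Qed.

Lemma is_derive_mulr {R : realType} (f g : R -> R) (x a b : R) :
  is_derive x 1 f a -> is_derive x 1 g b ->
  is_derive x 1 (fun y => f y * g y) (f x * b + g x * a).
Proof. exact: is_deriveM. Qed.

Lemma is_derive_mull {R : realType} (k : R) (f : R -> R) (x a : R) :
  is_derive x 1 f a -> is_derive x 1 (fun y => k * f y) (k * a).
Proof. exact: is_deriveZ. Qed.

Lemma derivable_is_derive1 {R : realType} (f : R -> R) (x : R) :
  derivable f x 1 -> is_derive x 1 f (derive1 f x).
Proof. by move=> df; rewrite derive1E; exact: derivableP. Qed.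

Lemma is_derive_shift {R : realType} (f : R -> R) (x h l : R) :
  is_derive (x + h) 1 f l -> is_derive x 1 (fun y => f (y + h)) l.
Proof.
move=> df; have dh : is_derive x 1 (fun y : R => y + h) (1 : R).
  by rewrite -[X in is_derive _ _ _ X]addr0; exact: is_derive_addr.
by rewrite -(mulr1 l); exact: (@is_derive1_comp _ f (fun y => y + h) x l 1 df dh).
Qed.

Lemma is_derive_slope_gt {R : realType} (f : R -> R) (x l m : R) :
  is_derive x 1 f l -> m < l ->
  \forall h \near 0^', m < h^-1 * (f (h + x) - f x).
Proof.
move=> [df dl] ml.
have := df; rewrite /derivable => /cvg_ex[k kP].
have kl : k = l by rewrite -dl; apply/esym/cvg_lim.
rewrite kl in kP.
have : \forall y \near l, m < y by apply: (@lt_nbhsr R).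
move/kP; rewrite /= => H; near=> h.
have : m < h^-1 *: ((f \o shift x) (h *: 1) - f x).
  by near: h; exact: H.
by rewrite /= [h *: 1]mulr1.
Unshelve. all: by end_near. Qed.

(** One-sided on purpose: in the maximum principle the minimum may lie at the final time, where only
    earlier times can be compared. *)
Lemma derive_at_right_min_le0 {R : realType} (f : R -> R) (a b l : R) :
  a < b -> is_derive b 1 f l -> (forall t, a <= t <= b -> f b <= f t) -> l <= 0.
Proof.
move=> ab dfl fmin; rewrite leNgt; apply/negP => l0.
have /nbhs_ballP[e /= e0 he] := is_derive_slope_gt _ _ _ _ dfl l0.
pose h := Num.min (e / 2) (b - a).
have h0 : 0 < h by rewrite lt_min subr_gt0 ab andbT divr_gt0.
have he2 : h <= e / 2 by rewrite ge_min lexx.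
have hb : h <= b - a by rewrite ge_min lexx orbT.
have : 0 < (- h)^-1 * (f (- h + b) - f b).
  apply: he; last by rewrite oppr_eq0 gt_eqF.
  by rewrite /ball /= sub0r opprK gtr0_norm//; lra.
rewrite invrN mulNr oppr_gt0 pmulr_rlt0 ?invr_gt0// subr_lt0 ltNge.
by rewrite fmin//; lra.
Qed.

Lemma derive_at_left_min_ge0 {R : realType} (f : R -> R) (a b l : R) :
  a < b -> is_derive a 1 f l -> (forall t, a <= t <= b -> f a <= f t) -> 0 <= l.
Proof.
move=> ab dfl fmin; rewrite leNgt; apply/negP => l0.
have dfl' : is_derive a 1 (- f) (- l) by exact: is_deriveN.
have /nbhs_ballP[e /= e0 he] := is_derive_slope_gt _ _ _ 0 dfl' ltac:(lra).
pose h := Num.min (e / 2) (b - a).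
have h0 : 0 < h by rewrite lt_min subr_gt0 ab andbT divr_gt0.
have he2 : h <= e / 2 by rewrite ge_min lexx.
have hb : h <= b - a by rewrite ge_min lexx orbT.
have : 0 < h^-1 * ((- f) (h + a) - (- f) a).
  apply: he; last by rewrite gt_eqF.
  by rewrite /ball /= sub0r normrN gtr0_norm//; lra.
rewrite pmulr_rgt0 ?invr_gt0// -[(- f) (h + a)]/(- f (h + a)) -[(- f) a]/(- f a).
have := fmin (h + a) ltac:(lra); lra.
Qed.

(** If [l < 0], then [g] vanishes at [c] and is negative just to its right, so by the mean value
    theorem [f] falls below [f c] there. *)
Lemma second_derive_at_min_ge0 {R : realType} (f g : R -> R) (a b c l : R) :
  a < c < b -> (forall x, a < x < b -> is_derive x 1 f (g x)) ->
  is_derive c 1 g l -> (forall x, a < x < b -> f c <= f x) ->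
  g c = 0 /\ 0 <= l.
Proof.
move=> /andP[ac cb] dfg dgl fmin.
have gc0 : g c = 0.
  have Df : is_derive c 1 f 0.
    apply: (@derive1_at_min _ f a b).
    - exact: ltW (lt_trans ac cb).
    - by move=> t; rewrite in_itv/= => /dfg tt; exact: ex_derive.
    - by rewrite in_itv /= ac cb.
    - by move=> t; rewrite in_itv/= => /fmin.
  have Dg := dfg c (introT andP (conj ac cb)).
  by have [_ <-] := Dg; have [_ ->] := Df.
split => //; rewrite leNgt; apply/negP => l0.
have dgl' : is_derive c 1 (- g) (- l) by exact: is_deriveN.
have /nbhs_ballP[e /= e0 he] := is_derive_slope_gt _ _ _ 0 dgl' ltac:(lra).
pose h := Num.min (e / 2) ((b - c) / 2).
have h0 : 0 < h by rewrite lt_min !divr_gt0// subr_gt0.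
have he2 : h <= e / 2 by rewrite ge_min lexx.
have hb : h <= (b - c) / 2 by rewrite ge_min lexx orbT.
have [x] := @MVT R f g c (c + h) ltac:(lra)
  ltac:(move=> x; rewrite in_itv/= => ?; apply: dfg; lra)
  ltac:(apply/continuous_in_subspaceT => x;
        rewrite inE/= in_itv/= => xx; apply: is_derive_cont; apply: dfg; lra).
rewrite in_itv/= => /andP[cx xh] fE.
have gx : g x < 0.
  have : 0 < (x - c)^-1 * ((- g) (x - c + c) - (- g) c).
    apply: he; last by rewrite gt_eqF// subr_gt0.
    by rewrite /ball /= sub0r normrN gtr0_norm ?subr_gt0//; lra.
  rewrite subrK /= pmulr_rgt0 ?invr_gt0 ?subr_gt0//.
  by rewrite -[(- g) x]/(- g x) -[(- g) c]/(- g c) gc0; lra.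
have := fmin (c + h) ltac:(lra).
by rewrite -subr_ge0 fE; nra.
Qed.

(** * Continuity in two variables and bounds on compact sets *)

Lemma continuous_pair_comp {T : topologicalType} {R : realType} (F : R -> R -> R)
    (phi psi : T -> R) (y : T) :
  {for y, continuous phi} -> {for y, continuous psi} ->
  {for (phi y, psi y), continuous (fun z : R * R => F z.1 z.2)} ->
  {for y, continuous (fun z => F (phi z) (psi z))}.
Proof. by move=> cphi cpsi cF; exact: continuous2_cvg cF cphi cpsi. Qed.

Lemma segment_continuous {R : realType} (f : R -> R) (a b : R) :
  (forall x, a <= x <= b -> {for x, continuous f}) ->
  {within `[a, b], continuous f}.
Proof.
move=> cf; apply/continuous_in_subspaceT => x; rewrite inE/= in_itv/=.
exact: cf.
Qed.

Lemma rectangle_bounded {R : realType} (F : R -> R -> R) (a b c d : R) :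
  (forall x y : R, a <= x <= b -> c <= y <= d ->
    {for (x, y), continuous (fun z : R * R => F z.1 z.2)}) ->
  exists2 M, 0 < M & forall x y, a <= x <= b -> c <= y <= d -> `|F x y| <= M.
Proof.
move=> cF; pose A := `[a, b] `*` `[c, d] : set (R * R).
have cA : compact A by apply: compact_setX; exact: segment_compact.
have cFA : {within A, continuous (fun z : R * R => F z.1 z.2)}.
  apply/continuous_in_subspaceT => -[x y]; rewrite inE => -[/=].
  by rewrite !in_itv/= => ax cy; exact: cF.
have /ex_strict_bound_gt0[M M0 HM] := compact_bounded (continuous_compact cFA cA).
exists M => // x y ax cy; apply/ltW/HM => /=; exists (x, y) => //.
Qed.

Lemma segment_bounded {R : realType} (f : R -> R) (a b : R) :
  (forall x : R, a <= x <= b -> {for x, continuous f}) ->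
  exists2 M, 0 < M & forall x : R, a <= x <= b -> `|f x| <= M.
Proof.
move=> cf; have [|M M0 HM] := rectangle_bounded (fun x _ => f x) a b 0 0.
  move=> x y xab _; apply: (@cvg_comp _ _ _ fst f _ (nbhs x)); last exact: cf.
  exact: cvg_fst.
by exists M => // x xab; apply: (HM x 0); rewrite ?lexx.
Qed.

Lemma derive_lipschitz {R : realType} (F h : R -> R) (a b C : R) :
  (forall z : R, a <= z <= b -> is_derive z 1 F (h z)) ->
  (forall z : R, a <= z <= b -> `|h z| <= C) ->
  forall x y : R, a <= x <= b -> a <= y <= b -> `|F x - F y| <= C * `|x - y|.
Proof.
move=> dF hC x y; wlog xy : x y / x <= y => [hwlog xab yab|xab yab].
  have [/hwlog|/ltW/hwlog] := leP x y; first exact.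
  by rewrite distrC (distrC y); exact.
have [z] := @MVT_segment R F h x y xy
  ltac:(move=> z; rewrite in_itv/= => ?; apply: dF; lra)
  ltac:(apply: segment_continuous => z xz; apply: is_derive_cont; apply: dF; lra).
rewrite in_itv/= => zxy FE; rewrite distrC FE normrM (distrC y).
by apply: ler_wpM2r => //; apply: hC; lra.
Qed.

(** The same [C] bounds [f'] on [[-K, K]] and is a Lipschitz constant there; it becomes the drift
    bound in the maximum principle for solutions with values in this interval. *)
Lemma C1_locally_lipschitz {R : realType} (f : R -> R) (K : R) : C1 f ->
  exists2 C, 0 < C & (forall r, `|r| <= K -> `|derive1 f r| <= C) /\
    (forall r s, `|r| <= K -> `|s| <= K -> `|f r - f s| <= C * `|r - s|).
Proof.
move=> [df cdf]; have [|C C0 HC] := segment_bounded (derive1 f) (- K) K.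
  by move=> x _; exact: cdf.
exists C => //; split => [r|r s]; first by rewrite ler_norml; exact: HC.
rewrite !(ler_norml _ K); apply: derive_lipschitz HC r s.
by move=> z _; exact: derivable_is_derive1.
Qed.

(** * Maximum principle *)

Lemma quadratic_dominates {R : realType} (A k : R) : 0 < k ->
  exists2 X : R, 0 < X & forall x, X <= `|x| -> A * (1 + `|x|) <= k * (1 + x ^+ 2).
Proof.
(* For [y = |x|] this threshold gives [y >= 1] and [2 |A| <= k y], hence
   [|A| (1 + y) <= 2 |A| y <= k y^2]. *)
move=> k0; exists (2 * `|A| / k + 1).
  by rewrite ltr_wpDl// divr_ge0 ?mulr_ge0// ltW.
move=> x; rewrite -(real_normK (num_real x)); move: `|x| => y.
move=> yX; have y1 : 1 <= y.
  by apply: le_trans yX; rewrite lerDr divr_ge0 ?mulr_ge0// ltW.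
have A2 : 2 * `|A| <= k * y.
  rewrite -ler_pdivrMl// mulrC; apply: le_trans yX.
  by rewrite lerDl.
have AA := ler_norm A.
apply: (@le_trans _ _ (`|A| * (1 + y))); first by apply: ler_wpM2r => //; lra.
have := normr_ge0 A; nra.
Qed.

(** The drift enters only through its bound, as [C |Zx|]; this covers both a linear drift [f'(w) Zx]
    and a difference of two values of [f]. Linear growth is what potentials of bounded functions
    satisfy. *)
Lemma maximum_principle {R : realType} (eps C A s T : R)
    (Z Zt Zx Zxx : R -> R -> R) :
  0 < eps -> 0 <= C ->
  (forall x t, s <= t <= T -> {for (x, t), continuous (fun z : R * R => Z z.1 z.2)}) ->
  (forall x, 0 <= Z x s) ->
  (forall x t, s <= t <= T -> - (A * (1 + `|x|)) <= Z x t) ->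
  (forall x t, s < t <= T ->
    [/\ is_derive t 1 (Z x) (Zt x t), is_derive x 1 (Z ^~ t) (Zx x t),
        is_derive x 1 (Zx ^~ t) (Zxx x t) &
        eps * Zxx x t - C * `|Zx x t| <= Zt x t]) ->
  forall x t, s <= t <= T -> 0 <= Z x t.
Proof.
move=> eps0 C0 Zc Z0 ZA Zpde x1 t1 /andP[st1 t1T].
rewrite leNgt; apply/negP => Z10.
pose l := 2 * eps + C + 1.
(* Minimize Z + k P: the penalty P grows faster than A (1 + |x|) at infinity,
   and l is such that P is a strict supersolution. *)
pose P (x t : R) := (1 + x ^+ 2) * expR (l * (t - s)).
have P_gt0 x t : 0 < P x t by rewrite mulr_gt0 ?expR_gt0// ltr_pwDl// sqr_ge0.
(* With this [k] the penalized function [Y] equals [Z x1 t1 / 2] at [(x1, t1)], which is still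
   negative. *)
pose k := - Z x1 t1 / (2 * P x1 t1).
have k0 : 0 < k by rewrite divr_gt0 ?oppr_gt0// mulr_gt0.
pose Y (x t : R) := Z x t + k * P x t.
have Y10 : Y x1 t1 < 0.
  rewrite /Y /k; have -> : - Z x1 t1 / (2 * P x1 t1) * P x1 t1 = - Z x1 t1 / 2.
    by field; rewrite gt_eqF.
  lra.
have [X0 X00 HX0] := quadratic_dominates A k k0.
(* Beyond [X0] the penalty outweighs the growth of [Z]; [|x1| + 1] keeps [(x1, t1)] off the lateral
   sides of the rectangle. *)
pose X := Num.max X0 (`|x1| + 1).
have XX0 : X0 <= X by rewrite le_max lexx.
have Xx1 : `|x1| + 1 <= X by rewrite le_max lexx orbT.
have YX x t : s <= t <= T -> X <= `|x| -> 0 <= Y x t.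
  move=> stT Xx; have /andP[st _] := stT.
  have := HX0 x ltac:(lra); have := ZA x t stT.
  have : k * (1 + x ^+ 2) <= k * P x t.
    rewrite ler_pM2l// /P ler_peMr// ?addr_ge0 ?sqr_ge0//.
    rewrite -expR0 ler_expR mulr_ge0//; first by rewrite /l; lra.
    by rewrite subr_ge0.
  rewrite /Y; lra.
have Pc : continuous (fun z : R * R => P z.1 z.2).
  move=> z; rewrite /P; apply: cvgM.
    apply: cvgD; first exact: cvg_cst.
    by rewrite expr2; under eq_fun do rewrite expr2; apply: cvgM; exact: cvg_fst.
  apply: (cvg_comp (fun z : R * R => l * (z.2 - s)) expR); last exact: continuous_expR.
  apply: cvgM; first exact: cvg_cst.
  by apply: cvgB; [exact: cvg_snd|exact: cvg_cst].
pose rect := `[- X, X] `*` `[s, t1].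
have [] := @compact_EVT_min _ R (fun z : R * R => Y z.1 z.2) rect.
- exists (x1, t1); split => /=; rewrite in_itv/=; last lra.
  by rewrite -ler_norml; lra.
- by apply: compact_setX; exact: segment_compact.
- apply/continuous_in_subspaceT => -[x t]; rewrite inE => -[/= _]; rewrite in_itv/= => tt.
  rewrite /Y; apply: cvgD; first by apply: Zc; lra.
  by apply: cvgM; [exact: cvg_cst|exact: Pc].
move=> [x0 t0]; rewrite inE => -[/=]; rewrite !in_itv/= => x0X st0 Ymin.
have {}Ymin x t : - X <= x <= X -> s <= t <= t1 -> Y x0 t0 <= Y x t.
  by move=> xX st; apply: (Ymin (x, t)); rewrite inE/=; split => /=; rewrite in_itv.
have Y00 : Y x0 t0 < 0.
  apply: le_lt_trans Y10; apply: Ymin; last lra.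
  by rewrite -ler_norml; lra.
have st0' : s < t0.
  case/andP: st0 => + _; rewrite le_eqVlt => /predU1P[st|//].
  have := Z0 x0; rewrite st; have := P_gt0 x0 t0; move: Y00; rewrite /Y; nra.
have x0X' : - X < x0 < X.
  rewrite -ltr_norml ltNge; apply/negP => Xx0.
  by have := YX x0 t0 ltac:(lra) Xx0; lra.
have [dt dx dxx pde] := Zpde x0 t0 ltac:(lra).
pose E := expR (l * (t0 - s)).
have E0 : 0 < E by exact: expR_gt0.
have Yt : Zt x0 t0 + k * (l * (1 + x0 ^+ 2) * E) <= 0.
  apply: (@derive_at_right_min_le0 _ (Y x0) s t0) => //; last first.
    by move=> t tt; apply: Ymin; lra.
  apply: is_derive_addr => //; apply: is_derive_mull.
  rewrite /P; apply: is_derive_eq.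
  by rewrite /GRing.scale/= -/E; ring.
have [] := @second_derive_at_min_ge0 _ (Y ^~ t0)
    (fun x => Zx x t0 + k * (2 * x * E)) (- X) X x0 (Zxx x0 t0 + k * (2 * E)).
- by [].
- move=> x xX; have [_ dx' _ _] := Zpde x t0 ltac:(lra).
  apply: is_derive_addr => //; apply: is_derive_mull.
  rewrite /P -/E; apply: is_derive_eq.
  by rewrite /GRing.scale/=; ring.
- apply: is_derive_addr => //; apply: is_derive_mull.
  apply: is_derive_eq.
  by rewrite /GRing.scale/=; ring.
- by move=> x xX; apply: Ymin; lra.
move=> Yx Yxx.
(* As [2 |x0| <= 1 + x0^2], the differential inequality at the minimum gives
   [Zt >= - (2 eps + C) k E (1 + x0^2)], while the time derivative of [Y] gives
   [Zt <= - l k E (1 + x0^2)]. The summand 1 in [l] makes these contradictory. *)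
have ZxE : Zx x0 t0 = - (k * (2 * x0 * E)) by lra.
have kE : 0 < k * E by exact: mulr_gt0.
have : `|Zx x0 t0| <= k * E * (1 + x0 ^+ 2).
  rewrite ZxE; have -> : - (k * (2 * x0 * E)) = k * E * (- (2 * x0)) by ring.
  rewrite normrM (gtr0_norm kE) (ler_pM2l kE).
  have := sqr_ge0 (x0 - 1); have := sqr_ge0 (x0 + 1).
  by rewrite ler_norml => ? ?; apply/andP; split; nra.
move=> Zxle.
have x2 : 0 <= x0 ^+ 2 by exact: sqr_ge0.
have : C * `|Zx x0 t0| <= C * (k * E * (1 + x0 ^+ 2)) by exact: ler_wpM2l.
have : eps * (- (k * (2 * E))) <= eps * Zxx x0 t0 by rewrite ler_pM2l//; lra.
move: Yt pde; rewrite /l; move: kE x2; move: (Zt x0 t0) (eps * Zxx x0 t0) (C * `|_|).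
move=> zt zxx czx kE x2.
have -> : k * ((2 * eps + C + 1) * (1 + x0 ^+ 2) * E) =
  (2 * eps + C + 1) * (k * E * (1 + x0 ^+ 2)) by ring.
have -> : eps * (- (k * (2 * E))) = - (2 * eps * (k * E)) by ring.
move: (k * E) kE => j j0; move: (x0 ^+ 2) x2 => y y0.
move=> h1 h2 h3 h4.
have : 0 < j * (1 + y) by rewrite mulr_gt0//; lra.
have : 0 <= eps * (j * y) by rewrite !mulr_ge0// ltW.
nra.
Qed.

(** * Consequences of the p-condition *)

(** Young's inequality for [w] and [q^(p - 1)] with the exponents [p] and [p / (p - 1)]. *)
Lemma powR_ge_tangent {R : realType} (p q w : R) : 1 < p -> 0 <= q -> 0 <= w ->
  q `^ p + p * q `^ (p - 1) * (w - q) <= w `^ p.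
Proof.
move=> p1 q0 w0.
have p0 : 0 < p by lra.
have p10 : 0 < p - 1 by lra.
have q'0 : 0 < p / (p - 1) by rewrite divr_gt0.
have := @conjugate_powR _ w (q `^ (p - 1)) p (p / (p - 1)) w0 (powR_ge0 _ _) p0 q'0.
rewrite -powRrM mulrCA divff ?gt_eqF// mulr1 => /(_ _)/wrap[|Y].
  by field; rewrite !gt_eqF.
have -> : q `^ p + p * q `^ (p - 1) * (w - q) =
  p * (w * q `^ (p - 1)) - p * (q * q `^ (p - 1)) + q `^ p by ring.
rewrite mulr_powRB1//.
have : p * (w * q `^ (p - 1)) <= p * (w `^ p / p + q `^ p / (p / (p - 1))).
  by rewrite ler_pM2l.
have -> : p * (w `^ p / p + q `^ p / (p / (p - 1))) = w `^ p + (p - 1) * q `^ p.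
  by field; rewrite !gt_eqF.
lra.
Qed.

Lemma uniform_cvg_pointwise {R : realType} (A : set R) (h : R -> R -> R)
    (g : R -> R) (F : set_system R) {FF : Filter F} (r : R) :
  A r -> {uniform A, (fun x => h eta x) @[eta --> F] --> g} ->
  h eta r @[eta --> F] --> g r.
Proof.
move=> Ar hg; apply/cvgrPdist_lt => e e0.
have := hg [set k : {uniform` A -> R} | `|g r - k r| < e]; apply.
apply/uniform_nbhs; exists [set xy : R * R | ball xy.1 e xy.2].
by split; [exact: (@entourage_ball R R (PosNum e0))|move=> k /= /(_ r Ar)].
Qed.

(** [Theta(y^2) / y^2] is the derivative of [y^-1 Phi(y^2)]. The mean value theorem thus trades the
    derivative of [Phi eta] for its values, which converge as [eta -> 0]. The factor
    [s^2 / y^2 >= 1] is dropped, which uses [m >= 0]. *)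
Lemma Theta_slope {R : realType} (Phi : R -> R -> R) (eta r s m : R) :
  0 < r -> r < s -> (forall x, 0 < x -> derivable (Phi eta) x 1) ->
  0 <= m -> (forall y, r < y < s -> m <= Theta Phi eta (y ^+ 2)) ->
  m * (s - r) <= s * Phi eta (s ^+ 2) - s ^+ 2 * Phi eta (r ^+ 2) / r.
Proof.
move=> r0 rs dPhi m0 mTheta.
have s0 : 0 < s by lra.
pose G (y : R) := y^-1 * Phi eta (y ^+ 2).
have dG (y : R) : 0 < y -> is_derive y 1 G (Theta Phi eta (y ^+ 2) / y ^+ 2).
  move=> y0; rewrite /G; apply: is_derive_eq.
    apply: is_derive_mulr.
      by apply: is_deriveV; rewrite gt_eqF.
    apply: (@is_derive1_comp _ (Phi eta) (fun y => y ^+ 2)).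
    by apply: derivable_is_derive1; apply: dPhi; rewrite exprn_gt0.
  rewrite /Theta /GRing.scale/=; field; rewrite gt_eqF//.
have [y] := @MVT R G (fun y => Theta Phi eta (y ^+ 2) / y ^+ 2) r s rs
  ltac:(move=> x; rewrite in_itv/= => ?; apply: dG; lra)
  ltac:(apply/continuous_in_subspaceT => x;
        rewrite inE/= in_itv/= => xx; apply: is_derive_cont; apply: dG; lra).
rewrite in_itv/= => rys GE.
have -> : s * Phi eta (s ^+ 2) - s ^+ 2 * Phi eta (r ^+ 2) / r =
    s ^+ 2 * (G s - G r) by rewrite /G; field; rewrite !gt_eqF.
rewrite GE mulrA ler_pM2r ?subr_gt0// mulrCA.
have mT := mTheta y rys.
apply: (le_trans mT); rewrite ler_peMr//; first exact: le_trans mT.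
rewrite ler_pdivlMr ?exprn_gt0//; last lra.
by rewrite mul1r; nra.
Qed.

(** For [0 < r < s], the limit [eta -> 0] in [Theta_slope] bounds the increment of [f(y) / y] from
    [r] to [s] from below by a multiple of [s - r]; letting [s] decrease to [r] gives the claim. *)
Lemma p_condition_growth {R : realType} (p a : R) (f : R -> R) :
  1 < p -> C1 f -> f 0 = 0 -> p_condition p a f ->
  forall r, 0 <= r -> a * r `^ p <= r * derive1 f r - f r.
Proof.
move=> p1 [df _] f0 [_ _ [Phi [Phismooth _ Phicvg [gamma [b [gamma0 a0 b0 HTheta]]]]]] r.
rewrite le_eqVlt => /predU1P[<-|r0].
  by rewrite powR0 ?f0 ?mulr0 ?mul0r ?subr0// gt_eqF//; lra.
have powE (y : R) : 0 < y -> (y ^+ 2) `^ (p / 2) = y `^ p.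
  move=> y0; rewrite -(@powR_mulrn _ y 2) ?ltW// -powRrM; congr (_ `^ _); lra.
have rp0 : 0 < r `^ p by exact: powR_gt0.
have step s : r <= s -> 0 <= s * f s - s ^+ 2 * (f r / r) - a * r `^ p * (s - r).
  rewrite le_eqVlt => /predU1P[<-|rs].
    by rewrite subrr mulr0 subr0 expr2 -mulrA [r * (f r / r)]mulrC divfK ?subrr// gt_eqF.
  have cv y : 0 < y -> Phi eta (y ^+ 2) @[eta --> 0^'+] --> f y.
    move=> y0; apply: (@uniform_cvg_pointwise _ `[y, y]%classic (fun eta r => Phi eta (r ^+ 2))).
      by rewrite /= in_itv/= lexx.
    by apply: Phicvg => //; exact: ltW.
  have bcv : b * eta `^ gamma @[eta --> 0^'+] --> (0 : R).
    rewrite -[X in _ --> X](mulr0 b); apply: cvgM; first exact: cvg_cst.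
    exact: powR_cvg0.
  rewrite subr_ge0.
  apply: (@ler_cvg_to _ (0 : R)^'+ _ R
    (fun eta => (a * r `^ p - b * eta `^ gamma) * (s - r))
    (fun eta => s * Phi eta (s ^+ 2) - s ^+ 2 * (Phi eta (r ^+ 2) / r))).
  - apply: cvgM; last exact: cvg_cst.
    by rewrite -[X in _ --> X]subr0; apply: cvgB; [exact: cvg_cst|exact: bcv].
  - apply: cvgB; (apply: cvgM; first exact: cvg_cst); first by apply: cv; lra.
    by apply: cvgM; [exact: cv|exact: cvg_cst].
  - near=> eta.
    have eta0 : 0 < eta by near: eta; exact: nbhs_right_gt.
    (* Small [eta] makes the lower bound for [Theta] nonnegative, as [Theta_slope] requires. *)
    have bs : b * eta `^ gamma < a * r `^ p.
      near: eta; apply: (cvgr_lt _ bcv); exact: mulr_gt0.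
    rewrite mulrA; apply: Theta_slope => //.
    + by move=> x x0; have [[_ /(_ 0%N)[]]] := Phismooth eta eta0; move=> + _ _; exact.
    + by rewrite subr_ge0 ltW.
    + move=> y /andP[ry ys].
      have y0 : 0 < y by lra.
      have HT : forall r, 0 < r -> a * r `^ (p / 2) - b * eta `^ gamma <= Theta Phi eta r.
        by near: eta; exact: HTheta.
      apply: le_trans (HT _ (exprn_gt0 2 y0)); rewrite powE// lerD2r ler_pM2l//.
      by apply: ge0_ler_powR; rewrite ?nnegrE; lra.
(* [N] vanishes at [r] and is nonnegative to its right, so its derivative at [r] is nonnegative,
   which is the claim. *)
pose N (s : R) := s * f s - s ^+ 2 * (f r / r) - a * r `^ p * (s - r).
have dN : is_derive r 1 N (r * derive1 f r - f r - a * r `^ p).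
  have dfr := derivable_is_derive1 _ _ (df r).
  rewrite /N; apply: is_derive_eq.
  by rewrite /GRing.scale/=; field; rewrite gt_eqF.
have Nr : N r = 0 by rewrite /N; field; rewrite gt_eqF.
rewrite -subr_ge0; apply: (@derive_at_left_min_ge0 _ N r (r + 1)) => //; first lra.
by move=> t /andP[rt _]; rewrite Nr; exact: step.
Unshelve. all: by end_near. Qed.

(** * The potential of a solution *)

Lemma integral_derive {R : realType} (H h : R -> R) (a b : R) : a < b ->
  (forall x, a <= x <= b -> is_derive x 1 H (h x)) ->
  (forall x, a <= x <= b -> {for x, continuous h}) ->
  (\int[@lebesgue_measure R]_(x in `[a, b]) (h x)%:E = (H b - H a)%:E)%E.
Proof.
move=> ab dH ch.
have cH x : a <= x <= b -> {for x, continuous H} by move=> /dH; exact: is_derive_cont.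
rewrite (@continuous_FTC2 R h H a b ab).
- by rewrite EFinB.
- exact: segment_continuous.
- split.
  + move=> x; rewrite in_itv/= => /andP[ax xb].
    by have [] := dH x ltac:(lra).
  + by apply: cvg_at_right_filter; apply: cH; lra.
  + by apply: cvg_at_left_filter; apply: cH; lra.
- move=> x; rewrite in_itv/= => /andP[ax xb].
  by have [_] := dH x ltac:(lra); rewrite derive1E.
Qed.

(** Differentiation under the integral sign, with a constant dominating [hx] on a compact rectangle.
    The new integrand [hx a] has the antiderivative [H], so only boundary values remain. *)
Lemma is_derive_integral01 {R : realType} (h hx : R -> R -> R) (H : R -> R)
    (a r : R) : 0 < r ->
  (forall x y : R, a - r <= x <= a + r -> 0 <= y <= 1 -> is_derive x 1 (h ^~ y) (hx x y)) ->
  (forall x y : R, a - r <= x <= a + r -> 0 <= y <= 1 -> {for y, continuous (h x)}) ->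
  (forall x y : R, a - r <= x <= a + r -> 0 <= y <= 1 ->
    {for (x, y), continuous (fun z : R * R => hx z.1 z.2)}) ->
  (forall y : R, 0 <= y <= 1 -> is_derive y 1 H (hx a y)) ->
  is_derive a 1 (fun x => \int[@lebesgue_measure R]_(y in `[0, 1]) h x y)
    (H 1 - H 0).
Proof.
move=> r0 dh ch chx dH.
have [M M0 HM] := rectangle_bounded hx (a - r) (a + r) 0 1 chx.
have Ia : `]a - r, a + r[%classic a by rewrite /= in_itv/=; lra.
have I_ x : `]a - r, a + r[%classic x -> a - r <= x <= a + r.
  by rewrite /= in_itv/=; lra.
have B_ (y : R) : `[0, 1]%classic y -> 0 <= y <= 1 by rewrite /= in_itv.
have intf x : `]a - r, a + r[%classic x ->
    (@lebesgue_measure R).-integrable `[0, 1] (EFin \o h x).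
  move=> /I_ xI; apply: continuous_compact_integrable; first exact: segment_compact.
  by apply: segment_continuous => y y01; exact: ch.
have derf1 x y : `]a - r, a + r[%classic x -> `[0, 1]%classic y -> derivable (h ^~ y) x 1.
  by move=> /I_ xI /B_ y01; have [] := dh x y xI y01.
have p1 x y : `]a - r, a + r[%classic x -> `[0, 1]%classic y -> partial1of2 h x y = hx x y.
  by move=> /I_ xI /B_ y01; have [_] := dh x y xI y01; rewrite partial1of2E.
have intG : (@lebesgue_measure R).-integrable `[0, 1] (EFin \o cst M).
  apply: continuous_compact_integrable; first exact: segment_compact.
  by apply: segment_continuous => ? ?; exact: cvg_cst.
have Gub x y : `]a - r, a + r[%classic x -> `[0, 1]%classic y -> `|partial1of2 h x y| <= cst M y.
  by move=> xI y01; rewrite p1//; exact: HM (I_ _ xI) (B_ _ y01).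
have mB : measurable (`[0, 1]%classic : set (measurableTypeR R)) by exact: measurable_itv.
have M0' (y : measurableTypeR R) : 0 <= cst M y by exact: ltW.
have D := @derivable_under_integral R _ (measurableTypeR R) (@lebesgue_measure R) h
  `[0, 1]%classic mB a (a - r) (a + r) Ia intf derf1 (cst M) M0' intG Gub.
have V := @differentiation_under_integral R _ (measurableTypeR R) (@lebesgue_measure R) h
  `[0, 1]%classic mB a (a - r) (a + r) Ia intf derf1 (cst M) M0' intG Gub.
apply: (is_derive_eq (derivable_is_derive1 _ _ D)).
rewrite V; transitivity (\int[@lebesgue_measure R]_(y in `[0, 1]) hx a y).
  by apply: eq_Rintegral => y; rewrite inE => y01; exact: p1.
rewrite /Rintegral (integral_derive H)//.
move=> y y01; apply: (continuous_pair_comp hx (cst a) id).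
- exact: cvg_cst.
- exact: cvg_id.
- by apply: chx => //=; lra.
Qed.

Lemma is_derive_integral_itv {R : realType} (g : R -> R) (s t : R) : s < t ->
  (forall x, s <= x -> {for x, continuous g}) ->
  is_derive t 1 (fun x => \int[@lebesgue_measure R]_(y in `[s, x]) g y) (g t).
Proof.
move=> st cg.
have [] := @continuous_FTC1_closed R g s t (t + 1) ltac:(lra).
- apply: continuous_compact_integrable; first exact: segment_compact.
  by apply: segment_continuous => x /andP[sx _]; exact: cg.
- exact: st.
- by apply: cg; lra.
by move=> D V; apply: (is_derive_eq (derivable_is_derive1 _ _ D)).
Qed.

(** As [g_x = w_t], the form [w dx + g dt] is closed. It is integrated from [(0, s)] to [(0, t)] and
    then to [(x, t)]; the base time [s] is positive since nothing is assumed at time 0. *)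
Lemma exists_potential {R : realType} (w wx wt g : R -> R -> R) (s : R) : 0 < s ->
  (forall x t : R, 0 < t ->
    [/\ is_derive x 1 (w ^~ t) (wx x t), is_derive t 1 (w x) (wt x t),
        is_derive x 1 (g ^~ t) (wt x t) &
        [/\ {for (x, t), continuous (fun z : R * R => w z.1 z.2)},
            {for (x, t), continuous (fun z : R * R => wx z.1 z.2)},
            {for (x, t), continuous (fun z : R * R => wt z.1 z.2)} &
            {for (x, t), continuous (fun z : R * R => g z.1 z.2)}]]) ->
  exists U : R -> R -> R, forall x t : R, s < t ->
    is_derive x 1 (U ^~ t) (w x t) /\ is_derive t 1 (U x) (g x t).
Proof.
move=> s0 hw.
(* The segment from 0 to x is rescaled to [0, 1], which avoids oriented
   integrals for x < 0. *)
exists (fun x t => \int[@lebesgue_measure R]_(y in `[0, 1]) (x * w (x * y) t) +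
                   \int[@lebesgue_measure R]_(y in `[s, t]) g 0 y) => x t st.
have t0 : 0 < t by lra.
have dxy (u v : R) : is_derive v 1 (fun v => u * v) u.
  by apply: is_derive_eq; rewrite /GRing.scale/= mulr1.
have dyx (u v : R) : is_derive v 1 (fun v => v * u) u.
  by under eq_fun do rewrite mulrC; exact: dxy.
have cxy (z : R * R) : {for z, continuous (fun z : R * R => z.1 * z.2)}.
  by apply: cvgM; [exact: cvg_fst|exact: cvg_snd].
split.
- rewrite -[w x t]addr0; apply: is_derive_addr.
  have -> : w x t = 1 * w (x * 1) t - 0 * w (x * 0) t by rewrite !mulr1 mul1r mul0r subr0.
  (* The [x]-derivative of [x w(x y, t)] is also the [y]-derivative of [y w(x y, t)], which goes
     from 0 to [w(x, t)]. *)
  apply: (@is_derive_integral01 _ (fun x y => x * w (x * y) t)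
    (fun x y => w (x * y) t + (x * y) * wx (x * y) t)
    (fun y => y * w (x * y) t) x 1) => //.
  + move=> x' y _ _; have [dw _ _ _] := hw (x' * y) t t0.
    apply: is_derive_eq.
      apply: is_derive_mulr.
      by apply: (@is_derive1_comp _ (w ^~ t) (fun x => x * y)).
    by rewrite mulr1; ring.
  + move=> x' y _ _; have [_ _ _ [cw _ _ _]] := hw (x' * y) t t0.
    apply: cvgM; first exact: cvg_cst.
    apply: (continuous_pair_comp w (fun y => x' * y) (cst t)) => //.
    * exact: is_derive_cont (dxy _ _).
    * exact: cvg_cst.
  + move=> x' y _ _; have [_ _ _ [cw cwx _ _]] := hw (x' * y) t t0.
    apply: cvgD.
      apply: (continuous_pair_comp w (fun z : R * R => z.1 * z.2) (cst t)) => //.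
      exact: cvg_cst.
    apply: cvgM; first exact: cxy.
    apply: (continuous_pair_comp wx (fun z : R * R => z.1 * z.2) (cst t)) => //.
    exact: cvg_cst.
  + move=> y _; have [dw _ _ _] := hw (x * y) t t0.
    apply: is_derive_eq.
      apply: is_derive_mulr.
      by apply: (@is_derive1_comp _ (w ^~ t) (fun y => x * y)).
    by rewrite mulr1; ring.
- have cg0 y : s <= y -> {for y, continuous (g 0)}.
    move=> sy; have [_ _ _ [_ _ _ cg]] := hw 0 y ltac:(lra).
    apply: (continuous_pair_comp g (cst 0) id) => //.
    exact: cvg_cst.
  (* The integrand [x wt(x y, t)] is the [y]-derivative of [g(x y, t)], so the first integral
     contributes [g(x, t) - g(0, t)] and the second one [g(0, t)]. *)
  have -> : g x t = (g (x * 1) t - g (x * 0) t) + g 0 t by rewrite mulr1 mulr0 subrK.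
  apply: is_derive_addr; last exact: is_derive_integral_itv.
  apply: (@is_derive_integral01 _ (fun t y => x * w (x * y) t)
    (fun t y => x * wt (x * y) t) (fun y => g (x * y) t) t (t / 2)).
  + lra.
  + move=> t' y t'I _; have [_ dw _ _] := hw (x * y) t' ltac:(lra).
    exact: is_derive_mull.
  + move=> t' y t'I _; have [_ _ _ [cw _ _ _]] := hw (x * y) t' ltac:(lra).
    apply: cvgM; first exact: cvg_cst.
    apply: (continuous_pair_comp w (fun y => x * y) (cst t')) => //.
    * exact: is_derive_cont (dxy _ _).
    * exact: cvg_cst.
  + move=> t' y t'I _; have [_ _ _ [_ _ cwt _]] := hw (x * y) t' ltac:(lra).
    apply: cvgM; first exact: cvg_cst.
    apply: (continuous_pair_comp wt (fun z : R * R => x * z.2) (fun z => z.1)).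
    * by apply: cvgM; [exact: cvg_cst|exact: cvg_snd].
    * exact: cvg_fst.
    * exact: cwt.
  + move=> y _; have [_ _ dg _] := hw (x * y) t t0.
    apply: is_derive_eq.
      by apply: (@is_derive1_comp _ (g ^~ t) (fun y => x * y)).
    by ring.
Qed.

(** * Potentials of bounded classical solutions *)

Section solution_potential.
Context {R : realType} (eps : R) (f : R -> R) (w : R -> R -> R) (K : R).
Context (f_C1 : C1 f) (w_sol : classical_solution eps f w).
Context (w_bd : forall x t : R, 0 < t -> `|w x t| <= K).

Let wt (x t : R) : R := derive1 (w x) t.
Let wx (x t : R) : R := derive1 (w ^~ t) x.
Let wxx (x t : R) : R := derive1 (wx ^~ t) x.

Lemma solution_derivatives (x t : R) : 0 < t ->
  [/\ is_derive t 1 (w x) (wt x t), is_derive x 1 (w ^~ t) (wx x t),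
      is_derive x 1 (wx ^~ t) (wxx x t) &
      wt x t + derive1 f (w x t) * wx x t = eps * wxx x t].
Proof.
move=> t0; have [dt dx dxx _ pde] := w_sol x t t0.
have dwx : is_derive x 1 (w ^~ t) (wx x t).
  exact: (derivable_is_derive1 (w ^~ t) x dx).
split; [exact: (derivable_is_derive1 (w x) t dt)|exact: dwx|
  exact: (derivable_is_derive1 (wx ^~ t) x dxx)|].
rewrite -pde; congr (_ + _).
have df := derivable_is_derive1 _ _ (f_C1.1 (w x t)).
have [_ <-] := is_derive1_comp df dwx.
by rewrite derive1E.
Qed.

Lemma solution_continuous (x t : R) : 0 < t ->
  {for (x, t), continuous (fun z : R * R => w z.1 z.2)}.
Proof. by move=> t0; have [_ _ _ [] ] := w_sol x t t0. Qed.

(** The equation in divergence form, [w_t = (eps w_x - f(w))_x], is the closedness condition for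
    these two derivatives. *)
Definition is_potential (s : R) (U : R -> R -> R) : Prop :=
  forall x t : R, s < t -> is_derive x 1 (U ^~ t) (w x t) /\
    is_derive t 1 (U x) (eps * wx x t - f (w x t)).

Lemma solution_potential (s : R) : 0 < s -> exists U, is_potential s U.
Proof.
move=> s0.
apply: (@exists_potential _ w wx wt (fun x t => eps * wx x t - f (w x t))) => // x t t0.
have [dt dx dxx pde] := solution_derivatives x t t0.
have [_ _ _ [cw cwt cwx _] _] := w_sol x t t0.
split; [exact: dx|exact: dt| |].
  have df := derivable_is_derive1 _ _ (f_C1.1 (w x t)).
  have -> : wt x t = eps * wxx x t - derive1 f (w x t) * wx x t by rewrite -pde addrK.
  exact: is_derive_subr _ _ _ _ _ (is_derive_mull _ _ _ _ dxx) (is_derive1_comp df dx).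
split; [exact: cw|exact: cwx|exact: cwt|].
apply: cvgB; first by apply: cvgM; [exact: cvg_cst|exact: cwx].
apply: (@cvg_comp _ _ _ (fun z : R * R => w z.1 z.2) f _ (nbhs (w x t))); first exact: cw.
exact: is_derive_cont _ _ _ (derivable_is_derive1 _ _ (f_C1.1 (w x t))).
Qed.

Context (s0 : R) (U : R -> R -> R) (s00 : 0 < s0) (U_pot : is_potential s0 U).

Lemma potential_lipschitz (x y t : R) : s0 < t -> `|U x t - U y t| <= K * `|x - y|.
Proof.
move=> st; apply: (@derive_lipschitz _ (U ^~ t) (w ^~ t) (- (`|x| + `|y|)) (`|x| + `|y|)).
- by move=> z _; have [] := U_pot z t st.
- by move=> z _; apply: w_bd; exact: lt_trans st.
- by have := normr_ge0 y; have := ler_norm x; have := ler_norm (- x); rewrite normrN; lra.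
- by have := normr_ge0 x; have := ler_norm y; have := ler_norm (- y); rewrite normrN; lra.
Qed.

(** Partial derivatives alone do not give joint continuity; but the Lipschitz bound in [x] is
    uniform in [t], so it combines with continuity in [t] at fixed [x]. *)
Lemma potential_continuous (x t : R) : s0 < t ->
  {for (x, t), continuous (fun z : R * R => U z.1 z.2)}.
Proof.
move=> st; have K0 : 0 <= K by apply: le_trans (w_bd x t _) => //; exact: lt_trans st.
have [_ dUt] := U_pot x t st.
have cU : (fun z : R * R => U x z.2) @ (x, t) --> U x t.
  apply: (@cvg_comp _ _ _ snd (U x) _ (nbhs t)); first exact: cvg_snd.
  exact: is_derive_cont dUt.
have cx : (fun z : R * R => K * `|z.1 - x|) @ (x, t) --> 0.
  rewrite -[X in _ --> X](mulr0 K) -(normr0 R) -(subrr x).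
  apply: cvgM; first exact: cvg_cst.
  by apply: cvg_norm; apply: cvgB; [exact: cvg_fst|exact: cvg_cst].
have ct : (fun z : R * R => z.2) @ (x, t) --> t by exact: cvg_snd.
apply/cvgrPdist_lt => e e0; near=> z => /=.
have zs : s0 < z.2 by near: z; exact: (cvgr_gt _ ct).
have h1 : `|U x t - U x z.2| < e / 2.
  by near: z; move/cvgrPdist_lt : cU; apply; rewrite divr_gt0.
have h2 : K * `|z.1 - x| < e / 2.
  by near: z; apply: (cvgr_lt _ cx); rewrite divr_gt0.
have h3 := potential_lipschitz z.1 x z.2 zs.
have := ler_distD (U x z.2) (U x t) (U z.1 z.2).
rewrite [`|U x z.2 - _|]distrC; lra.
Unshelve. all: by end_near. Qed.

Lemma potential_growth (s T : R) : s0 < s ->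
  exists2 B, 0 < B & forall x t : R, s <= t <= T -> `|U x t| <= B * (1 + `|x|).
Proof.
move=> ss; have [|B B0 HB] := segment_bounded (U 0) s T.
  by move=> t stT; have [_] := U_pot 0 t ltac:(lra); exact: is_derive_cont.
exists (B + `|K|) => [|x t stT]; first by rewrite ltr_pwDl.
have := potential_lipschitz x 0 t ltac:(lra); rewrite subr0 => UL.
have := HB t stT; have := ler_norm K; have x0 := normr_ge0 x.
have := ler_distD 0 (U x t) (U 0 t); have := ler_normD (U x t - U 0 t) (U 0 t).
rewrite subrK => h1 h2 h3 h4.
have : K * `|x| <= `|K| * `|x| by rewrite ler_wpM2r.
have : 0 <= B * `|x| by rewrite mulr_ge0// ltW.
have := normr_ge0 K; nra.
Qed.

End solution_potential.

(** * Decay of solutions with small time increments *)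

(* F stands for any antiderivative of w(., s), so that F x - F y is the integral
   of w(., s) over [y, x]. *)
Definition small_time_increments {R : realType} (w : R -> R -> R) (M : R) : Prop :=
  forall d t : R, 0 < d -> 0 < t -> exists2 s, 0 < s < t &
    forall F : R -> R, (forall x : R, is_derive x 1 F (w x s)) ->
      forall y x : R, y <= x -> - d <= F x - F y <= M + d.

(* The increments U(x + h, t) - U(x, t) of a potential are almost nonnegative at a
   small time, and they satisfy the maximum principle. *)
Lemma solution_ge0 {R : realType} (eps : R) (f : R -> R) (w : R -> R -> R) (K M : R) :
  0 < eps -> C1 f -> classical_solution eps f w ->
  (forall x t : R, 0 < t -> `|w x t| <= K) ->
  small_time_increments w M -> forall x t : R, 0 < t -> 0 <= w x t.
Proof.
move=> eps0 f_C1 w_sol w_bd w_incr x0 t0 t00.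
have K0 : 0 <= K by apply: le_trans (w_bd x0 t0 t00).
have [C C0 [_ f_lip]] := C1_locally_lipschitz f K f_C1.
rewrite leNgt; apply/negP => w0.
have [dtw dw _ _] := solution_derivatives _ _ _ f_C1 w_sol x0 t0 t00.
have /nbhs_ballP[r /= r0 hr] : \forall y \near x0, w y t0 < w x0 t0 / 2.
  by apply: (cvgr_lt _ (is_derive_cont _ _ _ dw)); lra.
(* On [[x0, x0 + h]] the solution is below [- m] at time [t0], so the increment of a potential there
   is less than [- m h]; hence the tolerance [m h] in the choice of [s]. *)
pose h := r / 2; pose m := - w x0 t0 / 2.
have h0 : 0 < h by rewrite /h; lra.
have m0 : 0 < m by rewrite /m; lra.
have [s /andP[s0 st] Hs] := w_incr (m * h) t0 (mulr_gt0 m0 h0) t00.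
(* The potential is based at [s / 2], so that its derivatives are available at time [s] itself. *)
have s20 : 0 < s / 2 by lra.
have [U U_pot] := solution_potential _ _ _ f_C1 w_sol (s / 2) s20.
have Ulip := potential_lipschitz _ _ _ _ w_bd _ _ s20 U_pot.
have Ucont := potential_continuous _ _ _ _ w_bd _ _ s20 U_pot.
have dU (x t : R) : s / 2 < t -> is_derive x 1 (U ^~ t) (w x t).
  by move=> /(U_pot x)[].
have dUh (x t : R) : s / 2 < t -> is_derive x 1 (fun x => U (x + h) t) (w (x + h) t).
  by move=> st'; exact: is_derive_shift (dU _ _ st').
(* Here [Zx = w(x + h, t) - w(x, t)], so the difference of the two values of [f] is at most
   [C |Zx|]. *)
have U0 : 0 <= U (x0 + h) t0 - U x0 t0 + m * h.
  apply: (@maximum_principle R eps C (K * h) s t0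
    (fun x t => U (x + h) t - U x t + m * h)
    (fun x t => (eps * derive1 (w ^~ t) (x + h) - f (w (x + h) t)) -
                (eps * derive1 (w ^~ t) x - f (w x t)) + 0)
    (fun x t => w (x + h) t - w x t + 0)
    (fun x t => derive1 (w ^~ t) (x + h) - derive1 (w ^~ t) x + 0)) => //.
  - exact: ltW.
  - move=> x t stt; apply: cvgD; last exact: cvg_cst.
    apply: cvgB; last by apply: Ucont; lra.
    apply: (continuous_pair_comp U (fun z : R * R => z.1 + h) (fun z : R * R => z.2)).
    + by apply: cvgD; [exact: cvg_fst|exact: cvg_cst].
    + exact: cvg_snd.
    + by apply: Ucont => /=; lra.
  - move=> x; have := Hs (U ^~ s) (fun x => dU x s ltac:(lra)) x (x + h) ltac:(lra).
    lra.
  - move=> x t stt; have := Ulip (x + h) x t ltac:(lra).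
    rewrite ler_norml addrAC subrr add0r (gtr0_norm h0) => /andP[+ _].
    have : 0 <= K * h * `|x| by rewrite !mulr_ge0// ltW.
    have := mulr_gt0 m0 h0; rewrite mulrDr mulr1; lra.
  - move=> x t stt.
    have t_gt0 : 0 < t by lra.
    have st2 : s / 2 < t by lra.
    have [_ dwx dwxx _] := solution_derivatives _ _ _ f_C1 w_sol x t t_gt0.
    have [_ dwxh dwxxh _] := solution_derivatives _ _ _ f_C1 w_sol (x + h) t t_gt0.
    split.
    + apply: is_derive_addr; apply: is_derive_subr.
        by have [_] := U_pot (x + h) t st2.
      by have [_] := U_pot x t st2.
    + by apply: is_derive_addr; apply: is_derive_subr; [exact: dUh|exact: dU].
    + apply: is_derive_addr; apply: is_derive_subr => //.
      exact: is_derive_shift dwxh.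
    + have := f_lip _ _ (w_bd (x + h) t t_gt0) (w_bd x t t_gt0).
      by rewrite !addr0 ler_norml => /andP[_]; lra.
  - by apply/andP; split; lra.
have [y] := @MVT R (U ^~ t0) (w ^~ t0) x0 (x0 + h) ltac:(lra)
  ltac:(move=> z _; apply: dU; lra)
  ltac:(apply: segment_continuous => z _; apply: is_derive_cont; apply: dU; lra).
rewrite in_itv/= => /andP[xy yx] UE.
have : w y t0 < w x0 t0 / 2.
  by apply: hr; rewrite /ball/= distrC gtr0_norm ?subr_gt0//; rewrite /h in yx; lra.
move: U0; rewrite -addrA [- _ + _]addrC addrA addrAC UE addrAC subrr add0r -mulrDl.
by rewrite pmulr_lge0// /m; lra.
Qed.

(** [Z = b - U] satisfies [Z_t = eps Z_xx + f(w)] with [Z_x = - w], and [f(0) = 0] makes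
    [|f(w)| <= C |w| = C |Z_x|]. *)
Lemma potential_le {R : realType} (eps : R) (f : R -> R) (w U : R -> R -> R)
    (K s0 s b : R) :
  0 < eps -> C1 f -> f 0 = 0 -> classical_solution eps f w ->
  (forall x t : R, 0 < t -> `|w x t| <= K) ->
  0 < s0 -> is_potential eps f w s0 U -> s0 < s ->
  (forall x, U x s <= b) -> forall x t, s <= t -> U x t <= b.
Proof.
move=> eps0 f_C1 f0 w_sol w_bd s00 U_pot ss Ub x0 t0 st0.
have [C C0 [_ f_lip]] := C1_locally_lipschitz f K f_C1.
have Ucont := potential_continuous _ _ _ _ w_bd _ _ s00 U_pot.
have [B B0 HB] := potential_growth _ _ _ _ w_bd _ _ s00 U_pot s t0 ss.
rewrite -subr_ge0.
apply: (@maximum_principle R eps C (B + `|b|) s t0 (fun x t => b - U x t)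
    (fun x t => 0 - (eps * derive1 (w ^~ t) x - f (w x t)))
    (fun x t => 0 - w x t) (fun x t => 0 - derive1 (w ^~ t) x)) => //.
- exact: ltW.
- move=> x t stt; apply: cvgB; first exact: cvg_cst.
  by apply: Ucont; lra.
- by move=> x; rewrite subr_ge0.
- move=> x t stt; have := HB x t stt; rewrite ler_norml => /andP[_].
  have := ler_norm (- b); rewrite normrN.
  have : 0 <= `|b| * `|x| by rewrite mulr_ge0.
  by rewrite mulrDl (mulrDr `|b|) mulr1; lra.
- move=> x t stt; have t_gt0 : 0 < t by lra.
  have [_ dwx _ _] := solution_derivatives _ _ _ f_C1 w_sol x t t_gt0.
  have [dUx dUt] := U_pot x t ltac:(lra).
  split; try by apply: is_derive_subr.
  have := f_lip _ 0 (w_bd x t t_gt0).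
  rewrite f0 !subr0 normr0 => /(_ (le_trans (normr_ge0 _) (w_bd x t t_gt0))).
  by rewrite !sub0r normrN ler_norml => /andP[]; lra.
- by rewrite st0 lexx.
Qed.

(** The power [w^p] is replaced by its tangent at the value [q] taken at the target point. The
    tangent lies below the power, agrees with it at that point and is affine in [w], so that it
    inherits the linear equation of [w]. *)
Lemma potential_lower_bound {R : realType} (eps p a : R) (f : R -> R)
    (w U : R -> R -> R) (K s0 s c : R) :
  0 < eps -> 1 < p -> 0 < a -> C1 f ->
  (forall r, 0 <= r -> a * r `^ p <= r * derive1 f r - f r) ->
  classical_solution eps f w ->
  (forall x t : R, 0 < t -> `|w x t| <= K) ->
  (forall x t : R, 0 < t -> 0 <= w x t) ->
  0 < s0 -> is_potential eps f w s0 U -> s0 < s ->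
  (forall x, c <= U x s) ->
  forall x t, s <= t -> a * (t - s) * w x t `^ p <= U x t - c.
Proof.
move=> eps0 p1 a0 f_C1 f_growth w_sol w_bd w_ge0 s00 U_pot ss Uc x0 t0 st0.
have t00 : 0 < t0 by lra.
have [C C0 [df_bd _]] := C1_locally_lipschitz f K f_C1.
have Ucont := potential_continuous _ _ _ _ w_bd _ _ s00 U_pot.
have wcont := solution_continuous _ _ _ w_sol.
have [B B0 HB] := potential_growth _ _ _ _ w_bd _ _ s00 U_pot s t0 ss.
have K0 : 0 <= K by apply: le_trans (w_bd x0 t0 t00).
pose q := w x0 t0; pose m := p * q `^ (p - 1).
have q0 : 0 <= q by exact: w_ge0.
have m0 : 0 <= m by rewrite mulr_ge0 ?powR_ge0//; lra.
have qp0 : 0 <= q `^ p by exact: powR_ge0.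
rewrite -subr_ge0.
have -> : U x0 t0 - c - a * (t0 - s) * w x0 t0 `^ p =
  U x0 t0 - c - a * (t0 - s) * (q `^ p + m * (w x0 t0 - q)).
  by rewrite -/q subrr mulr0 addr0.
apply: (@maximum_principle R eps C (B + `|c| + a * (t0 - s) * (q `^ p + m * K)) s t0
    (fun x t => U x t - c - a * (t - s) * (q `^ p + m * (w x t - q)))
    (fun x t => (eps * derive1 (w ^~ t) x - f (w x t)) -
                (a * (t - s) * (m * derive1 (w x) t) + (q `^ p + m * (w x t - q)) * a))
    (fun x t => w x t - a * (t - s) * (m * derive1 (w ^~ t) x))
    (fun x t => derive1 (w ^~ t) x -
                a * (t - s) * (m * derive1 (fun y => derive1 (w ^~ t) y) x))) => //.
- exact: ltW.
- move=> x t stt; apply: cvgB.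
    by apply: cvgB; [apply: Ucont; lra|exact: cvg_cst].
  apply: cvgM.
    apply: cvgM; first exact: cvg_cst.
    by apply: cvgB; [exact: cvg_snd|exact: cvg_cst].
  apply: cvgD; first exact: cvg_cst.
  apply: cvgM; first exact: cvg_cst.
  by apply: cvgB; [apply: wcont; lra|exact: cvg_cst].
- by move=> x; rewrite subrr mulr0 mul0r subr0 subr_ge0.
- move=> x t stt; have t_gt0 : 0 < t by lra.
  have := HB x t stt; rewrite ler_norml => /andP[+ _].
  have := ler_norm c; have x1 := normr_ge0 x.
  have : 0 <= `|c| * `|x| by rewrite mulr_ge0.
  have e1 : q `^ p + m * (w x t - q) <= q `^ p + m * K.
    rewrite lerD2l ler_wpM2l//; have := w_bd x t t_gt0.
    by rewrite ler_norml => /andP[_]; lra.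
  have D0 : 0 <= q `^ p + m * K by rewrite addr_ge0// mulr_ge0.
  have e2 : a * (t - s) * (q `^ p + m * (w x t - q)) <= a * (t0 - s) * (q `^ p + m * K).
    apply: (@le_trans _ _ (a * (t - s) * (q `^ p + m * K))).
      by rewrite (ler_wpM2l (mulr_ge0 (ltW a0) _))//; lra.
    by rewrite (ler_wpM2r D0)// (ler_wpM2l (ltW a0))//; lra.
  have : 0 <= a * (t0 - s) * (q `^ p + m * K) * `|x|.
    by rewrite mulr_ge0// mulr_ge0// mulr_ge0 ?(ltW a0)//; lra.
  by move: e2; set P := a * (t0 - s) * _; set Q := a * (t - s) * _; lra.
- move=> x t stt; have t_gt0 : 0 < t by lra.
  have [dwt dwx dwxx pde] := solution_derivatives _ _ _ f_C1 w_sol x t t_gt0.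
  have [dUx dUt] := U_pot x t ltac:(lra).
  have ts0 : 0 <= t - s by lra.
  split.
  + apply: is_derive_subr.
      rewrite -[X in is_derive _ _ _ X]subr0; exact: is_derive_subr.
    apply: is_derive_mulr.
      by apply: is_derive_eq; rewrite /GRing.scale/=; ring.
    by apply: is_derive_eq; rewrite /GRing.scale/=; ring.
  + apply: is_derive_subr.
      by rewrite -[X in is_derive _ _ _ X]subr0; exact: is_derive_subr.
    apply: is_derive_mull.
    by apply: is_derive_eq; rewrite /GRing.scale/=; ring.
  + by apply: is_derive_subr => //; do 2 apply: is_derive_mull.
  (* By the equation for [w] there remains [Zt - eps Zxx + f' Zx = (w f' - f) - a (q^p + m (w -
     q))], which is nonnegative by [growth] and [tangent]; moreover [- C |Zx| <= - f' Zx]. *)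
  + have tangent := powR_ge_tangent p q (w x t) p1 q0 (w_ge0 x t t_gt0).
    have growth := f_growth (w x t) (w_ge0 x t t_gt0).
    have := df_bd (w x t) (w_bd x t t_gt0).
    move: pde growth tangent; rewrite -/m.
    move: (derive1 f (w x t)) (derive1 (w ^~ t) x) (derive1 (w x) t) (f (w x t))
      (derive1 (fun y => derive1 (w ^~ t) y) x) => f' wx wt fw wxx pde growth tangent f'C.
    set Zx := (w x t - _).
    have : - (C * `|Zx|) <= - (f' * Zx).
      rewrite lerN2; apply: (le_trans (ler_norm _)).
      by rewrite normrM ler_wpM2r.
    have : a * (q `^ p + m * (w x t - q)) <= w x t * f' - fw.
      by apply: le_trans growth; rewrite ler_pM2l.
    have wtE : wt = eps * wxx - f' * wx by rewrite -pde addrK.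
    rewrite wtE /Zx; move: (q `^ p + m * (w x t - q)) (C * _); clear.
    move=> y z h1 h2; lra.
- by rewrite st0 lexx.
Qed.

(** At a small time [s] the values of the potential fill at most an interval of length [M + d]. Its
    upper end persists by [potential_le], and [potential_lower_bound], measured from its lower end,
    bounds [w^p]; then [d] tends to 0. *)
Lemma classical_decay {R : realType} (eps p a : R) (f : R -> R)
    (w : R -> R -> R) (K M : R) :
  0 < eps -> 1 < p -> 0 < a -> C1 f -> f 0 = 0 ->
  (forall r, 0 <= r -> a * r `^ p <= r * derive1 f r - f r) ->
  classical_solution eps f w ->
  (forall x t : R, 0 < t -> `|w x t| <= K) ->
  0 <= M -> small_time_increments w M ->
  forall x t, 0 < t -> a * t * w x t `^ p <= M.
Proof.
move=> eps0 p1 a0 f_C1 f0 f_growth w_sol w_bd M0 w_incr x0 t0 t00.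
have w_ge0 := solution_ge0 _ _ _ _ _ eps0 f_C1 w_sol w_bd w_incr.
have W0 : 0 <= a * w x0 t0 `^ p by rewrite mulr_ge0 ?powR_ge0// ltW.
suff H d : 0 < d -> d <= t0 -> a * (t0 - d) * w x0 t0 `^ p <= M + d.
  apply/ler_addgt0Pr => e e0.
  (* The loss is [d] on the right and [a d w^p] on the left, hence the factor [1 + a w^p]. *)
  pose d := Num.min t0 (e / (1 + a * w x0 t0 `^ p)).
  have d0 : 0 < d by rewrite lt_min t00 divr_gt0//; lra.
  have := H d d0 ltac:(by rewrite ge_min lexx).
  have : d * (1 + a * w x0 t0 `^ p) <= e.
    by rewrite -ler_pdivlMr ?ltr_wpDr// ge_min lexx orbT.
  by move: (w x0 t0 `^ p) => y; lra.
move=> d0 dt0; have [s /andP[s0 sd] Hs] := w_incr d d d0 d0.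
have s20 : 0 < s / 2 by lra.
have ss : s / 2 < s by lra.
have [U U_pot] := solution_potential _ _ _ f_C1 w_sol (s / 2) s20.
have {}Hs := Hs (U ^~ s) (fun x => (U_pot x s ss).1).
have Uosc x y : U x s - U y s <= M + d.
  have [yx|/ltW xy] := leP y x; first by have := Hs _ _ yx; lra.
  by have := Hs _ _ xy; lra.
pose A := range (U ^~ s); pose c := inf A.
have A_lb y : lbound A (U y s - (M + d)).
  by move=> _ [x _ <-]; have := Uosc y x; lra.
have cU x : c <= U x s.
  by apply: ge_inf; [exists (U 0 s - (M + d)); exact: A_lb|exists x].
have Uc y : U y s <= c + (M + d).
  by rewrite -lerBlDr; apply: lb_le_inf; [exists (U 0 s); exists 0|exact: A_lb].
have up := potential_le _ _ _ _ _ _ _ _ eps0 f_C1 f0 w_sol w_bd s20 U_pot ss Uc x0 t0 ltac:(lra).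
have low := potential_lower_bound _ _ _ _ _ _ _ _ _ _ eps0 p1 a0 f_C1 f_growth w_sol w_bd
  w_ge0 s20 U_pot ss cU x0 t0 ltac:(lra).
have : a * (t0 - d) * w x0 t0 `^ p <= a * (t0 - s) * w x0 t0 `^ p.
  by rewrite (ler_wpM2r (powR_ge0 _ _))// (ler_wpM2l (ltW a0))//; lra.
lra.
Qed.

(** * Integrable data *)

Lemma normL1E {R : realType} (g : R -> R) :
  normL1 g = (\int[@lebesgue_measure R]_x `|(g x)%:E|)%E.
Proof. by rewrite /normL1 Lnorm1. Qed.

Lemma lebesgue_aeS {R : realType} (P Q : R -> Prop) : (forall x, P x -> Q x) ->
  {ae @lebesgue_measure R, forall x, P x} -> {ae @lebesgue_measure R, forall x, Q x}.
Proof.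
move=> PQ; apply: (@filterS _ _ (@ae_filter_ringOfSetsType _ (measurableTypeR R) R
  (@lebesgue_measure R))).
exact: PQ.
Qed.

Lemma measurable_abse_EFin {R : realType} (g : R -> R) : measurable_fun setT g ->
  measurable_fun [set: measurableTypeR R] (fun x => `|(g x)%:E|%E).
Proof. by move=> mg; apply: measurableT_comp => //; apply/measurable_EFinP; exact: mg. Qed.

Lemma L1_integrable {R : realType} (g : R -> R) :
  L1 g -> (@lebesgue_measure R).-integrable setT (EFin \o g).
Proof. by move=> /Lfun1_integrable. Qed.

Lemma L1B {R : realType} (g h : R -> R) : L1 g -> L1 h -> L1 (fun x => g x - h x).
Proof.
move=> /L1_integrable ig /L1_integrable ih; apply/Lfun1_integrable.
by rewrite /comp; under eq_fun do rewrite EFinB; exact: integrableB.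
Qed.

Lemma L1_measurable {R : realType} (g : R -> R) : L1 g -> measurable_fun setT g.
Proof. by move=> /L1_integrable/integrableP[/measurable_EFinP]. Qed.

Lemma normL1_fin_num {R : realType} (g : R -> R) : L1 g -> normL1 g \is a fin_num.
Proof.
move=> /L1_integrable/integrableP[mg ig].
by rewrite normL1E ge0_fin_numE// integral_ge0.
Qed.

Lemma integral_le_normL1 {R : realType} (g : R -> R) (A : set (measurableTypeR R)) :
  measurable A -> L1 g ->
  (`|\int[@lebesgue_measure R]_(x in A) (g x)%:E| <= normL1 g)%E.
Proof.
move=> mA Lg; have mg := L1_measurable g Lg.
apply: (le_trans (@le_abse_integral _ _ R (@lebesgue_measure R) A (EFin \o g) mA _)).
  by apply/measurable_EFinP; exact: measurable_funTS.
rewrite normL1E; apply: ge0_subset_integral => //.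
by apply: measurableT_comp => //; exact/measurable_EFinP.
Qed.

(** [F x - F y] is the integral of [v] over [[y, x]] plus that of [w - v]. The first lies between 0
    and the norm of [v], as [v >= 0]; the second is at most [d] in absolute value. *)
Lemma increment_normL1 {R : realType} (v w F : R -> R) (d x y : R) :
  L1 v -> (forall z, 0 <= v z) -> L1 w -> (normL1 (fun z => w z - v z)%R <= d%:E)%E ->
  continuous w -> (forall z : R, is_derive z 1 F (w z)) -> y <= x ->
  - d <= F x - F y <= fine (normL1 v) + d.
Proof.
move=> Lv v0 Lw wvd cw dF; rewrite le_eqVlt => /predU1P[<-|yx].
  have d0 : 0 <= d by rewrite -lee_fin (le_trans _ wvd)// normL1E integral_ge0.
  by rewrite subrr oppr_le0 d0 addr_ge0// fine_ge0// normL1E integral_ge0.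
have FE := integral_derive F w y x yx (fun z _ => dF z) (fun z _ => cw z).
have mI : measurable (`[y, x]%classic : set (measurableTypeR R)) by exact: measurable_itv.
have iS (g : R -> R) : L1 g -> (@lebesgue_measure R).-integrable `[y, x] (EFin \o g).
  by move=> /L1_integrable; apply: integrableS => //; exact: measurableT.
have Lwv := L1B _ _ Lw Lv.
have : (\int[@lebesgue_measure R]_(z in `[y, x]) (w z)%:E =
  \int[@lebesgue_measure R]_(z in `[y, x]) (v z)%:E +
  \int[@lebesgue_measure R]_(z in `[y, x]) (w z - v z)%R%:E)%E.
  rewrite -(integralD mI (iS _ Lv) (iS _ Lwv)).
  by apply: eq_integral => z _; rewrite -EFinD addrC subrK.
have Iv := integral_le_normL1 _ _ mI Lv.
have Iwv := le_trans (integral_le_normL1 _ _ mI Lwv) wvd.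
have Iv0 : (0 <= \int[@lebesgue_measure R]_(z in `[y, x]) (v z)%:E)%E.
  by apply: integral_ge0 => z _; rewrite lee_fin.
have fv := integrable_fin_num mI (iS _ Lv).
have fwv := integrable_fin_num mI (iS _ Lwv).
rewrite FE; move: Iv Iv0 Iwv; rewrite -(fineK fv) -(fineK fwv) -(fineK (normL1_fin_num _ Lv)).
move: (fine _) (fine _) (fine _) => n b c.
rewrite -EFinD !abse_EFin !lee_fin => cn c0 bd [->].
by move: cn bd; rewrite !ler_norml /= => /andP[_ +] /andP[]; lra.
Qed.

Lemma Loo_fin_num {R : realType} (v : R -> R) : Loo v -> normLoo v \is a fin_num.
Proof.
move=> /andP[_]; rewrite inE /= => vfin.
by rewrite ge0_fin_numE//; exact: Lnorm_ge0.
Qed.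

(** The sup norm of [v] serves as [K], and convergence to [v] in the L^1 norm as [t -> 0] provides
    the small time increments, with the L^1 norm of [v] as [M]. *)
Lemma bounded_solution_decay {R : realType} (eps p a : R) (f v : R -> R)
    (w : R -> R -> R) :
  0 < eps -> 1 < p -> 0 < a -> C1 f -> f 0 = 0 ->
  (forall r, 0 <= r -> a * r `^ p <= r * derive1 f r - f r) ->
  L1 v -> Loo v -> (forall x, 0 <= v x) -> bounded_solution eps f v w ->
  forall x t, 0 < t -> 0 <= w x t /\ a * t * w x t `^ p <= fine (normL1 v).
Proof.
move=> eps0 p1 a0 f_C1 f0 f_growth Lv Loov v0 [w_sol w_bd Lw w_cvg] x t t0.
have nf := Loo_fin_num _ Loov.
have {}w_bd y s : 0 < s -> `|w y s| <= fine (normLoo v).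
  move=> /(w_bd y); rewrite ler_norml -(fineK nf) -EFinN !lee_fin.
  exact.
have M0 : 0 <= fine (normL1 v) by rewrite fine_ge0// normL1E integral_ge0.
have incr : small_time_increments w (fine (normL1 v)).
  move=> d T d0 T0.
  have [s [s0 sT sd]] : exists s, [/\ 0 < s, s < T &
      (normL1 (fun x => w x s - v x)%R < d%:E)%E].
    near (0 : R)^'+ => s; exists s; split; near: s.
    - exact: nbhs_right_gt.
    - exact: nbhs_right_lt.
    - apply: (w_cvg [set e | e < d%:E]%E).
      by apply: open_ereal_lt'; rewrite lte_fin.
  exists s; first by rewrite s0.
  move=> F dF y z yz; apply: (@increment_normL1 _ v (w ^~ s)) => //.
  - exact: Lw.
  - exact: ltW.
  - move=> r; have [_ dw _ _] := solution_derivatives _ _ _ f_C1 w_sol r s s0.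
    exact: is_derive_cont _ _ _ dw.
split.
  exact: solution_ge0 eps0 f_C1 w_sol w_bd incr x t t0.
exact: classical_decay eps0 p1 a0 f_C1 f0 f_growth w_sol w_bd M0 incr x t t0.
Unshelve. all: by end_near. Qed.

(** * Truncated data and passage to the limit *)

Lemma L1_approximation {R : realType} (u0 : R -> R) : L1 u0 ->
  {ae @lebesgue_measure R, forall x, 0 <= u0 x} ->
  exists v : nat -> R -> R,
    [/\ forall n, L1 (v n) /\ Loo (v n), forall n x, 0 <= v n x,
        forall n, (normL1 (v n) <= normL1 u0)%E &
        normL1 (fun x => v n x - u0 x) @[n --> \oo] --> 0%E].
Proof.
move=> Lu u0ge0; have mu := L1_measurable _ Lu.
(* Replacing values outside [[0, n]] by 0 makes [v n] nonnegative everywhere, although [u0] is so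
   only almost everywhere, and keeps [|v n| <= |u0|], the bound for dominated convergence. *)
pose v (n : nat) (x : R) := if 0 <= u0 x <= n%:R then u0 x else 0.
have mv n : measurable_fun setT (v n).
  apply: measurable_fun_ifT => //.
  by apply: measurable_and; exact: measurable_fun_ler.
have v_le n x : `|v n x| <= `|u0 x|.
  by rewrite /v; case: ifP => // _; rewrite normr0.
have iu := L1_integrable _ Lu.
have Lv n : L1 (v n).
  apply/Lfun1_integrable; apply: le_integrable iu => //.
    apply/measurable_EFinP. exact: mv.
  by move=> x _; rewrite !abse_EFin lee_fin.
exists v; split.
- move=> n; split => //; apply/andP; split; first by rewrite inE /=; exact: mv.
  rewrite inE /= /finite_norm unlock; case: ifPn => // _.
  apply: (@le_lt_trans _ _ n%:R%:E); last by rewrite ltry.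
  apply/ess_supP; apply: aeW => x /=; rewrite lee_fin /v.
  case: ifP => [/andP[h1 h2]|_]; last by rewrite normr0.
  by rewrite ger0_norm.
- by move=> n x; rewrite /v; case: ifP => // /andP[].
- move=> n; rewrite !normL1E; apply: ge0_le_integral => //.
  + exact: measurable_abse_EFin (mv n).
  + exact: measurable_abse_EFin mu.
  + by move=> x _; rewrite !abse_EFin lee_fin.
- under eq_fun do rewrite normL1E.
  have [] := @dominated_convergence _ _ R (@lebesgue_measure R) setT measurableT
    (fun n => EFin \o v n) (EFin \o u0) (EFin \o (fun x => `|u0 x|)).
  + by move=> n; apply/measurable_EFinP; exact: mv.
  + by apply/measurable_EFinP; exact: mu.
  + apply: lebesgue_aeS u0ge0 => x ux _ /=.
    apply: cvg_near_cst; near=> n; rewrite /v ux /=.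
    by rewrite ifT//; near: n; exact: nbhs_infty_ger.
  + have := Lfun_norm Lu; exact: L1_integrable.
  + by apply: aeW => x n _; rewrite abse_EFin lee_fin.
  by move=> _ + _; under eq_fun do under eq_integral do rewrite -EFinB.
Unshelve. all: by end_near. Qed.

(** The positive part [h] of [|u| - B] is at most [|w n - u|] for every [n], so its integral is 0
    and [h] vanishes almost everywhere. *)
Lemma L1_limit_ae_bound {R : realType} (u : R -> R) (w : nat -> R -> R) (B : R) :
  L1 u -> (forall n, L1 (w n)) -> (forall n x, `|w n x| <= B) ->
  normL1 (fun x => w n x - u x) @[n --> \oo] --> 0%E ->
  {ae @lebesgue_measure R, forall x, `|u x| <= B}.
Proof.
move=> Lu Lw wB wu; pose h x := Num.max (`|u x| - B) 0.
have mu := L1_measurable _ Lu.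
have mh : measurable_fun setT h.
  apply: measurable_maxr => //; apply: measurable_funB => //.
  exact: measurableT_comp.
have h0 x : 0 <= h x by rewrite le_max lexx orbT.
have ih n : (\int[@lebesgue_measure R]_x `|(h x)%:E| <= normL1 (fun x => w n x - u x)%R)%E.
  have mwu := L1_measurable _ (L1B _ _ (Lw n) Lu).
  rewrite normL1E; apply: ge0_le_integral => //.
  - exact: measurable_abse_EFin mh.
  - exact: measurable_abse_EFin mwu.
  move=> x _; rewrite !abse_EFin lee_fin (ger0_norm (h0 x)) ge_max normr_ge0 andbT.
  have := wB n x; have := ler_distD 0 (u x) 0; have := ler_normB (w n x) (w n x - u x).
  by rewrite opprB addrC subrK; lra.
have : (\int[@lebesgue_measure R]_x `|(h x)%:E| = 0)%E.
  apply/eqP; rewrite eq_le integral_ge0// andbT.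
  by apply: (cvge_ge _ wu); apply: nearW => n; exact: ih.
move=> /(ae_eq_integral_abs _ measurableT _).1 => /(_ ltac:(apply/measurable_EFinP; exact: mh)).
apply: lebesgue_aeS => x /(_ I) [hx].
by have : `|u x| - B <= h x by [rewrite le_max lexx]; rewrite hx subr_le0.
Qed.

Theorem corollary4p6 (R : realType) (eps p a : R) (f u0 : R -> R)
    (u : R -> R -> R)
    (eps_gt0 : 0 < eps) (p_gt1 : 1 < p)
    (f_C1 : C1 f) (f_0 : f 0 = 0) (df_0 : derive1 f 0 = 0)
    (df_Holder : locally_Holder (derive1 f))
    (f_pcond : p_condition p a f)
    (u0_L1 : L1 u0)
    (u0_ge0 : {ae @lebesgue_measure R, forall x, 0 <= u0 x})
    (u_sol : L1_solution eps f u0 u) :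
  forall t : R, 0 < t ->
    (normLoo (u ^~ t) <=
       normL1 u0 `^ p^-1 * ((a * t) `^ (- p^-1))%:E)%E.
Proof.
move=> t t0.
have a0 : 0 < a by have [_ _ [Phi [_ _ _ [gamma [b []]]]]] := f_pcond.
have growth := p_condition_growth _ _ _ p_gt1 f_C1 f_0 f_pcond.
have [v [Lv v0 v_le v_cvg]] := L1_approximation _ u0_L1 u0_ge0.
have [Lu /(_ v Lv v_cvg)[w [w_sol w_cvg]]] := u_sol.
have nf := normL1_fin_num _ u0_L1.
have N0 : 0 <= fine (normL1 u0) by rewrite fine_ge0// normL1E integral_ge0.
have at0 : 0 < a * t by exact: mulr_gt0.
rewrite -(fineK nf) poweR_EFin -EFinM.
set B := (X in (_ <= X%:E)%E).
(* The truncations have L^1 norm at most that of [u0], so one bound [B] serves for all [n]. *)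
have wB n x : `|w n x t| <= B.
  have [w0 wp] := bounded_solution_decay _ _ _ _ _ _ eps_gt0 p_gt1 a0 f_C1 f_0 growth
    (Lv n).1 (Lv n).2 (v0 n) (w_sol n) x t t0.
  rewrite ger0_norm//.
  have -> : w n x t = (w n x t `^ p) `^ p^-1.
    by rewrite -powRrM divff ?powRr1// gt_eqF//; lra.
  have -> : B = (fine (normL1 u0) / (a * t)) `^ p^-1.
    rewrite powRM ?invr_ge0 ?(ltW at0)//.
    by rewrite -(powR_inv1 (ltW at0)) -powRrM mulN1r//.
  have ip0 : 0 <= p^-1 by rewrite invr_ge0; lra.
  apply: ge0_ler_powR; rewrite ?nnegrE ?powR_ge0 ?(divr_ge0 N0 (ltW at0))//.
  rewrite ler_pdivlMr// mulrC (le_trans wp)// fine_le//.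
  exact: normL1_fin_num (Lv n).1.
have := L1_limit_ae_bound (u ^~ t) (fun n => w n ^~ t) B (Lu t t0) _ wB (w_cvg t t0).
move=> /(_ _)/wrap[n|]; first by have [_ _ + _] := w_sol n; exact.
(* The norm is an essential supremum if the whole space has positive measure and 0 otherwise; the
   second case only asks for [0 <= B]. *)
move=> uB; rewrite /normLoo unlock; case: ifPn => [_|_].
  by apply/ess_supP; apply: lebesgue_aeS uB => x; rewrite lee_fin.
by rewrite lee_fin /B mulr_ge0// powR_ge0.
Qed.
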